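(* For every integer $n \geq 5$, $$\sigma(K_5 - C_4, n) = 4n-4.$$
   Context: All graphs are finite and simple. A sequence $S=(d_1,\dots,d_n)$ of non-negative integers is called graphical if there is a simple graph $G$ of order $n$ whose degree sequence $(d(v_1),\dots,d(v_n))$ is precisely $S$; such a $G$ is called a realization of $S$. Write $\sigma(S)=d_1+d_2+\cdots+d_n$. For a graph $H$, a graphical sequence $S$ is potentially $H$-graphical if there is a realization of $S$ containing $H$ as a subgraph (not necessarily induced). The number $\sigma(H,n)$ denotes the minimum even integer $l$ such that every $n$-term graphical sequence $S$ with $\sigma(S)\geq l$ is potentially $H$-graphical. $K_5$ is the complete graph on $5$ vertices, $C_4$ is the cycle on $4$ vertices, and $K_5-C_4$ is the graph (on $5$ vertices) obtained from $K_5$ by removing the four edges of a $4$-cycle $C_4$. *)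

(* Defs.v *)
From mathcomp Require Import all_boot.
From mathcomp Require Import boolp.

Set Implicit Arguments.
Unset Strict Implicit.
Unset Printing Implicit Defensive.

Record sgraph (V : finType) := SGraph {
  adj :> rel V;
  adj_sym : symmetric adj;
  adj_irr : irreflexive adj
}.

Definition degree (V : finType) (G : sgraph V) (v : V) : nat :=
  #|[set w | G v w]|.

(* Not necessarily induced: edges of H go to edges of G, injectively on
   vertices. *)
Definition contains (V W : finType) (G : sgraph V) (H : sgraph W) : Prop :=
  exists f : W -> V, injective f /\ forall x y, H x y -> G (f x) (f y).

Definition realizes (n : nat) (G : sgraph 'I_n) (S : n.-tuple nat) : Prop :=
  forall i, degree G i = tnth S i.

Definition graphical (n : nat) (S : n.-tuple nat) : Prop :=
  exists G : sgraph 'I_n, realizes G S.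

Definition potentially (W : finType) (H : sgraph W) (n : nat)
    (S : n.-tuple nat) : Prop :=
  exists G : sgraph 'I_n, realizes G S /\ contains G H.

Definition forces (W : finType) (H : sgraph W) (n l : nat) : Prop :=
  forall S : n.-tuple nat, graphical S -> l <= sumn S -> potentially H S.

(* Degree sums are at most n ^ 2, so every larger l qualifies vacuously. *)
Lemma ex_even_forces (W : finType) (H : sgraph W) (n : nat) :
  exists l, ~~ odd l && `[< forces H n l >].
Proof.
exists (n * n).+1.*2; rewrite odd_double /=; apply/asboolP => S [G GS].
suff le_nn : sumn S <= n * n.
  move=> /leq_trans/(_ le_nn); rewrite doubleS -addnn.
  by rewrite ltnNge (leq_trans (leq_addr _ _) (leqnSn _)).
rewrite sumnE big_tuple -[X in X * _]card_ord -sum_nat_const leq_sum // => i _.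
by rewrite -GS (leq_trans (max_card _)) ?card_ord.
Qed.

Definition sigma (W : finType) (H : sgraph W) (n : nat) : nat :=
  ex_minn (ex_even_forces H n).

Lemma complete_sym n : symmetric [rel x y : 'I_n | x != y].
Proof. by move=> x y /=; rewrite eq_sym. Qed.

Lemma complete_irr n : irreflexive [rel x y : 'I_n | x != y].
Proof. by move=> x; rewrite /= eqxx. Qed.

Definition complete_graph n : sgraph 'I_n :=
  SGraph (@complete_sym n) (@complete_irr n).

(* The condition x != y only matters for n = 1; this is a cycle for n >= 3. *)
Definition cycle_adj n : rel 'I_n :=
  [rel x y | (x != y) && ((y == ordS x) || (x == ordS y))].

Lemma cycle_sym n : symmetric (@cycle_adj n).
Proof. by move=> x y; rewrite /cycle_adj /= eq_sym orbC. Qed.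

Lemma cycle_irr n : irreflexive (@cycle_adj n).
Proof. by move=> x; rewrite /cycle_adj /= eqxx. Qed.

Definition cycle_graph n : sgraph 'I_n := SGraph (@cycle_sym n) (@cycle_irr n).

Definition remove_adj (V W : finType) (G : sgraph V) (H : sgraph W)
    (f : W -> V) : rel V :=
  [rel x y | G x y &&
     ~~ [exists a, exists b, [&& f a == x, f b == y & H a b]]].

Lemma remove_sym (V W : finType) (G : sgraph V) (H : sgraph W) (f : W -> V) :
  symmetric (remove_adj G H f).
Proof.
move=> x y; rewrite /remove_adj /= adj_sym; congr (_ && ~~ _).
by apply/existsP/existsP => -[a /existsP[b /and3P[xa yb ab]]];
  exists b; apply/existsP; exists a; rewrite xa yb adj_sym.
Qed.

Lemma remove_irr (V W : finType) (G : sgraph V) (H : sgraph W) (f : W -> V) :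
  irreflexive (remove_adj G H f).
Proof. by move=> x; rewrite /remove_adj /= adj_irr. Qed.

Definition remove_edges (V W : finType) (G : sgraph V) (H : sgraph W)
    (f : W -> V) : sgraph V :=
  SGraph (@remove_sym V W G H f) (@remove_irr V W G H f).

(* The removed 4-cycle is 0 - 1 - 2 - 3 - 0. *)
Definition K5_minus_C4 : sgraph 'I_5 :=
  remove_edges (complete_graph 5) (cycle_graph 4)
    (widen_ord (isT : 4 <= 5)).

(* Main.v *)
(** [K5 - C4] is the bowtie, two triangles sharing a vertex.

    Lower bound: join two adjacent vertices to [n - 2] independent ones. The
    degree sequence [(n-1, n-1, 2, ..., 2)] has sum [4n - 6], and in each of its
    realizations the two vertices of degree [n - 1] meet every edge, whereas
    covering the edges of a bowtie takes three vertices.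

    Upper bound: a vertex of degree at most 2 can be deleted and put back after
    the rest has been rearranged (on five vertices the rest is [K4]), so assume
    that all degrees are at least 3; as [4n - 4 > 3n], some [v] has degree at
    least 4. Among the realizations, choose one for which the neighbours of [v]
    have the largest degree sum, then, with this neighbourhood fixed, one with
    the most edges inside it. If no realization has a bowtie, the neighbourhood
    [N] of [v] has no two disjoint edges, and 2-switches show in turn that it
    contains no triangle, no path with two edges and no edge. The engine is the
    following: if [x] and [y] in [N] are not adjacent, a neighbour [r] of [x]
    outside [N] is adjacent to every neighbour of [y] but [v], for otherwise a
    switch would create the edge [xy]; as [r] has degree at most that of [y],
    it has almost no other neighbour. *)
Require Import Defs.
From mathcomp Require Import all_boot.
From mathcomp Require Import boolp zify.

Set Implicit Arguments.
Unset Strict Implicit.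
Unset Printing Implicit Defensive.

(** * Adjacency and extremal choices *)

Lemma adj_neq (V : finType) (G : sgraph V) x y : G x y -> x != y.
Proof. by apply: contraTneq => ->; rewrite adj_irr. Qed.

(** Used twice to choose an extremal realization. As [P] is a mere proposition, its values are made
    decidable classically. *)
Lemma exists_max (T : Type) (P : T -> Prop) (f : T -> nat) (b : nat) :
    (exists t, P t) -> (forall t, P t -> f t <= b) ->
  exists t, P t /\ forall u, P u -> f u <= f t.
Proof.
move=> [t0 Pt0] f_le_b.
have ex_val : exists m, `[< exists t, P t /\ f t = m >].
  by exists (f t0); apply/asboolP; exists t0.
have val_le m : `[< exists t, P t /\ f t = m >] -> m <= b.
  by move=> /asboolP[t [/f_le_b ? <-]].
case: (ex_maxnP ex_val val_le) => m /asboolP[t [Pt <-]] max_t.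
by exists t; split=> // u Pu; apply/max_t/asboolP; exists u.
Qed.

(** * Switching two edges while keeping all degrees *)

Definition same_edge (V : eqType) (a b x y : V) : bool :=
  (x == a) && (y == b) || (x == b) && (y == a).

Lemma same_edge_sym (V : eqType) (a b x y : V) :
  same_edge a b x y = same_edge a b y x.
Proof. by rewrite /same_edge orbC [X in X || _]andbC [X in _ || X]andbC. Qed.

Lemma same_edgeC (V : eqType) (a b x y : V) :
  same_edge a b x y = same_edge b a x y.
Proof. by rewrite /same_edge orbC. Qed.

(** The 2-switch replacing the edges [ab] and [cd] by [ac] and [bd]. The guard [x != y] keeps it
    irreflexive even if [a = c] or [b = d]. *)
Definition switch_adj (V : finType) (G : sgraph V) (a b c d : V) : rel V :=
  [rel x y | (x != y) &&
     [|| [&& G x y, ~~ same_edge a b x y & ~~ same_edge c d x y],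
         same_edge a c x y | same_edge b d x y]].

Lemma switch_sym (V : finType) (G : sgraph V) a b c d :
  symmetric (switch_adj G a b c d).
Proof.
by move=> x y; rewrite /switch_adj /= eq_sym adj_sym !(same_edge_sym _ _ x y).
Qed.

Lemma switch_irr (V : finType) (G : sgraph V) a b c d :
  irreflexive (switch_adj G a b c d).
Proof. by move=> x; rewrite /switch_adj /= eqxx. Qed.

Definition switch (V : finType) (G : sgraph V) (a b c d : V) : sgraph V :=
  SGraph (@switch_sym V G a b c d) (@switch_irr V G a b c d).

Lemma switchE (V : finType) (G : sgraph V) a b c d x y :
  switch G a b c d x y = (x != y) &&
     [|| [&& G x y, ~~ same_edge a b x y & ~~ same_edge c d x y],
         same_edge a c x y | same_edge b d x y].
Proof. by []. Qed.

(** Together with [switch_swap], this symmetry carries the degree count at [a] over to the other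
    three ends. *)
Lemma switch_reverse (V : finType) (G : sgraph V) a b c d :
  switch G a b c d =2 switch G b a d c.
Proof.
move=> x y; rewrite !switchE (same_edgeC b a) (same_edgeC d c).
by rewrite [same_edge a c x y || _]orbC.
Qed.

Lemma switch_swap (V : finType) (G : sgraph V) a b c d :
  switch G a b c d =2 switch G c d a b.
Proof.
move=> x y; rewrite !switchE (same_edgeC c a) (same_edgeC d b).
by rewrite [~~ same_edge a b x y && _]andbC.
Qed.

Section Switch.

Variables (V : finType) (G : sgraph V) (a b c d : V).
Hypotheses (Gab : G a b) (Gcd : G c d) (nGac : ~~ G a c) (nGbd : ~~ G b d).
Hypotheses (neq_ac : a != c) (neq_bd : b != d).

Lemma switch_added : switch G a b c d a c.
Proof. by rewrite switchE /same_edge !eqxx neq_ac /= orbT. Qed.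

Lemma switch_kept x y :
    G x y -> ~~ same_edge a b x y -> ~~ same_edge c d x y ->
  switch G a b c d x y.
Proof. by move=> Gxy nab ncd; rewrite switchE (adj_neq Gxy) Gxy nab ncd. Qed.

Lemma switch_nbr :
  [set w | switch G a b c d a w] = c |: ([set w | G a w] :\ b).
Proof.
have neq_ab := adj_neq Gab.
have neq_ad : a != d by apply: contraNneq nGac => ->; rewrite adj_sym.
apply/setP=> w; rewrite !inE switchE /same_edge !eqxx /=.
rewrite (negbTE neq_ab) (negbTE neq_ac) (negbTE neq_ad) /= !andbT !orbF.
have [->|_] := eqVneq w c; first by rewrite neq_ac orbT.
rewrite /= orbF [RHS]andbC; case: (eqVneq a w) => [<-|//].
by rewrite adj_irr.
Qed.

Lemma degree_switch_end : degree (switch G a b c d) a = degree G a.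
Proof.
rewrite /degree switch_nbr cardsU1 !inE (negbTE nGac) andbF.
by rewrite [in RHS](cardsD1 b) inE Gab.
Qed.

End Switch.

Lemma eq_degree (V : finType) (G G' : sgraph V) :
  G =2 G' -> degree G =1 degree G'.
Proof. by move=> eqG x; apply: eq_card => y; rewrite !inE eqG. Qed.

Lemma degree_switch (V : finType) (G : sgraph V) a b c d :
    G a b -> G c d -> ~~ G a c -> ~~ G b d -> a != c -> b != d ->
  degree (switch G a b c d) =1 degree G.
Proof.
move=> Gab Gcd nGac nGbd neq_ac neq_bd x.
have [->|neq_xa] := eqVneq x a; first exact: degree_switch_end.
have [->|neq_xb] := eqVneq x b.
  rewrite (eq_degree (@switch_reverse _ G a b c d)).
  by apply: degree_switch_end; rewrite // adj_sym.
have [->|neq_xc] := eqVneq x c.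
  rewrite (eq_degree (@switch_swap _ G a b c d)).
  by apply: degree_switch_end; rewrite // 1?adj_sym // eq_sym.
have [->|neq_xd] := eqVneq x d.
  rewrite (eq_degree (@switch_swap _ G a b c d)).
  rewrite (eq_degree (@switch_reverse _ G c d a b)).
  by apply: degree_switch_end; rewrite // 1?adj_sym // 1?eq_sym // adj_sym.
apply: eq_card => y; rewrite !inE switchE /same_edge.
rewrite (negbTE neq_xa) (negbTE neq_xb) (negbTE neq_xc) (negbTE neq_xd) /=.
by rewrite andbT orbF; case: eqVneq => [<-|//]; rewrite adj_irr.
Qed.

Lemma switch_other (V : finType) (G : sgraph V) a b c d v :
    v != a -> v != b -> v != c -> v != d ->
  switch G a b c d v =1 G v.
Proof.
move=> /negbTE va /negbTE vb /negbTE vc /negbTE vd y.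
rewrite switchE /same_edge va vb vc vd /= andbT orbF.
by case: eqVneq => [<-|//]; rewrite adj_irr.
Qed.

(** * Bowties and the neighbourhood of a vertex in an extremal realization *)

Lemma nbr_avoiding (V : finType) (G : sgraph V) (s : seq V) x :
  size s < degree G x -> exists2 w, G x w & w \notin s.
Proof.
move=> lt_s; have [w|sub_s] := pickP [pred w | G x w && (w \notin s)].
  by case/andP; exists w.
suff: degree G x <= size s by rewrite leqNgt lt_s.
apply: leq_trans (card_size s); apply/subset_leq_card/subsetP => w.
by rewrite inE => Gxw; move: (sub_s w); rewrite /= Gxw => /negbFE.
Qed.

Definition bowtie (V : finType) (G : sgraph V) : Prop :=
  exists c x1 y1 x2 y2,
    [/\ [&& G c x1, G c y1 & G x1 y1], [&& G c x2, G c y2 & G x2 y2]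
      & [&& x1 != x2, x1 != y2, y1 != x2 & y1 != y2]].

Section LocalMatching.

Variables (V : finType) (G : sgraph V) (v : V).

Let outer r := ~~ G v r && (r != v).

(** The neighbourhood is that of [G], the edges are those of [H]. Each edge counts twice, as two
    ordered pairs, which does not affect maximality. *)
Definition edges_inside (H : sgraph V) : {set V * V} :=
  [set z | [&& G v z.1, G v z.2 & H z.1 z.2]].

Hypothesis no_bowtie : forall H : sgraph V, degree H =1 degree G -> ~ bowtie H.
Hypothesis deg_nbr : forall x, G v x -> 3 <= degree G x.
Hypothesis deg_v : 4 <= degree G v.
Hypothesis nbr_top :
  forall x r, G v x -> ~~ G v r -> r != v -> degree G r <= degree G x.
Hypothesis inside_max : forall H : sgraph V, degree H =1 degree G ->
  H v =1 G v -> #|edges_inside H| <= #|edges_inside G|.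

(** Two disjoint edges between neighbours of [v] form a bowtie centred at [v]. The form with [H]
    serves for graphs obtained by a switch. *)
Lemma no_matching (H : sgraph V) a b c d :
    degree H =1 degree G -> H v =1 G v -> G v a -> G v b -> G v c -> G v d ->
    H a b -> H c d -> a != c -> a != d -> b != c -> b != d -> False.
Proof.
move=> degH nbrH va vb vc vd ab cd neq_ac neq_ad neq_bc neq_bd.
apply: (no_bowtie degH); exists v, a, b, c, d.
by rewrite !nbrH va vb vc vd ab cd neq_ac neq_ad neq_bc neq_bd.
Qed.

Lemma no_matchingG a b c d : G v a -> G v b -> G v c -> G v d ->
    G a b -> G c d -> a != c -> a != d -> b != c -> b != d -> False.
Proof. exact: no_matching. Qed.

Lemma outer_neq x r : G v x -> outer r -> x != r.
Proof. by move=> vx /andP[vr _]; apply: contraNneq vr => <-. Qed.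

Lemma switch_nbr_v x p y q : G v x -> outer p -> G v y -> q != v ->
  switch G x p y q v =1 G v.
Proof.
move=> vx /andP[_ pv] vy qv; apply: switch_other; rewrite ?(adj_neq vx) //.
- by rewrite eq_sym.
- exact: adj_neq vy.
- by rewrite eq_sym.
Qed.

(** Otherwise switching [xp], [yq] into [xy], [pq] would gain an edge inside the neighbourhood and
    lose none, as [p] and [q] are outer. *)
Lemma outer_nbrs_adj x y p q : G v x -> G v y -> x != y -> ~~ G x y ->
  outer p -> outer q -> G x p -> G y q -> p != q -> G p q.
Proof.
move=> vx vy neq_xy nxy op oq xp yq neq_pq; apply: contraT => npq.
have degH := degree_switch xp yq nxy npq neq_xy neq_pq.
have nbrH := switch_nbr_v vx op vy (andP oq).2.
suff /proper_card : edges_inside G \proper edges_inside (switch G x p y q).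
  by rewrite ltnNge inside_max.
apply/properP; split; last first.
  by exists (x, y); rewrite !inE vx vy; [exact: switch_added | exact: nxy].
apply/subsetP=> -[a b] abG.
have /and3P[va vb ab]: [&& G v a, G v b & G a b] by move: abG; rewrite inE.
rewrite inE va vb.
apply: switch_kept => //=; rewrite /same_edge.
  by rewrite (negbTE (outer_neq va op)) (negbTE (outer_neq vb op)) andbF.
by rewrite (negbTE (outer_neq va oq)) (negbTE (outer_neq vb oq)) andbF.
Qed.

(** Here the switch loses the inside edge [yc], so counting does not suffice; but the new edge [xy]
    and the surviving edge [cz] are disjoint. *)
Lemma outer_nbr_adj x y c z r : G v x -> G v y -> G v c -> G v z -> outer r ->
  x != y -> ~~ G x y -> G x r -> G y c -> G c z -> z != x -> z != y -> G r c.
Proof.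
move=> vx vy vc vz or neq_xy nxy xr yc cz neq_zx neq_zy; apply: contraT => nrc.
have neq_rc : r != c by rewrite eq_sym outer_neq.
have neq_xc : x != c by apply: contraNneq nxy => ->; rewrite adj_sym.
have degH := degree_switch xr yc nxy nrc neq_xy neq_rc.
have cv : c != v by rewrite eq_sym (adj_neq vc).
have nbrH := switch_nbr_v vx or vy cv.
have Hxy : switch G x r y c x y by exact: switch_added.
have Hcz : switch G x r y c c z.
  rewrite switch_kept // /same_edge.
    by rewrite (eq_sym c x) (negbTE neq_xc) (negbTE neq_zx) andbF.
  by rewrite (eq_sym c y) (negbTE (adj_neq yc)) (negbTE neq_zy) andbF.
exfalso; apply: (no_matching degH nbrH vx vy vc vz Hxy Hcz) => //.
- by rewrite eq_sym.
- exact: adj_neq yc.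
- by rewrite eq_sym.
Qed.

(** A fourth neighbour [i] of [v] is adjacent to none of [a], [b], [c], while its neighbours other
    than [v] are outer and adjacent to all three. Two of these, [p] and [q], yield the bowtie of
    triangles [abp] and [acq]. *)
Lemma no_triangle a b c : G v a -> G v b -> G v c -> G a b -> G b c -> G a c ->
  False.
Proof.
move=> va vb vc ab bc ac.
have [i vi] := nbr_avoiding (s := [:: a; b; c]) deg_v.
rewrite !inE !negb_or => /and3P[ia ib ic].
have neq_ab := adj_neq ab; have neq_bc := adj_neq bc; have neq_ac := adj_neq ac.
have nia : ~~ G i a.
  apply/negP=> ia'; exact: (no_matchingG vi va vb vc ia' bc).
have nib : ~~ G i b.
  apply/negP=> ib'; apply: (no_matchingG vi vb va vc ib' ac) => //.
  by rewrite eq_sym.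
have nic : ~~ G i c.
  apply/negP=> ic'.
  by apply: (no_matchingG vi vc va vb ic' ab); rewrite // eq_sym.
have nbr_i w : G i w -> w != v -> [&& G w a, G w b & G w c].
  move=> iw wv.
  have ow : outer w.
    rewrite /outer wv andbT; apply/negP=> vw.
    by apply: (no_matchingG vi vw va vb) => //;
      apply: contraTneq iw => ->.
  apply/and3P; split.
  - by apply: (outer_nbr_adj vi vb va vc); rewrite // 1?adj_sym // eq_sym.
  - by apply: (outer_nbr_adj vi va vb vc); rewrite // eq_sym.
  - by apply: (outer_nbr_adj vi va vc vb); rewrite // 1?adj_sym // eq_sym.
have [p ip pv] := nbr_avoiding (s := [:: v]) (ltnW (deg_nbr vi)).
have [q iq] := nbr_avoiding (s := [:: v; p]) (deg_nbr vi).
rewrite !inE !negb_or in pv *; move=> /andP[qv qp].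
have /and3P[pa pb pc] := nbr_i p ip pv.
have /and3P[qa qb qc] := nbr_i q iq qv.
apply: (@no_bowtie G) => //; exists a, b, p, c, q.
rewrite !(adj_sym G a) !(adj_sym G b) in ab ac pb *.
rewrite ab ac pa qa pb (adj_sym G c) qc neq_bc !(eq_sym _ q) qp.
by rewrite (adj_neq pc) (adj_neq qb).
Qed.

(** The common outcome of the switching arguments; the degree counts based on it serve both isolated
    vertices and leaves of the neighbourhood. *)
Let transfers x y :=
  forall r s, outer r -> G x r -> G y s -> s != v -> s != r -> G r s.

(* As [deg r <= deg y], the vertices [x], [y] (if adjacent to [r]) and the
   neighbours of [y] except [v] and [r] leave [r] no further neighbour. *)
Lemma transfers_nbr x y r w : G v x -> G v y -> x != y -> ~~ G x y ->
    transfers x y -> outer r -> G x r -> G r w -> w != x -> w != y ->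
  G y w.
Proof.
move=> vx vy neq_xy nxy trans_xy or xr rw neq_wx neq_wy.
apply: contraT => nyw; have rv : r != v by case/andP: or.
have vr : ~~ G v r by case/andP: or.
have := nbr_top vy vr rv; rewrite leqNgt => /negP[].
set B := [set s | G y s].
have sub_r : w |: (x |: (B :\ v :\ r)) \subset [set s | G r s].
  apply/subsetP=> s; rewrite !inE => /or3P[/eqP->|/eqP->|/and3P[sr sv ys]] //.
    by rewrite adj_sym.
  exact: trans_xy.
have yv : v \in B by rewrite inE adj_sym.
have cardB : degree G y = (#|B :\ v|).+1 by rewrite /degree (cardsD1 v) -/B yv.
have card_wx : #|w |: (x |: (B :\ v :\ r))| = (#|B :\ v :\ r|).+2.
  rewrite !cardsU1 !inE (negbTE neq_wx) (negbTE nyw) !andbF.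
  by rewrite adj_sym (negbTE nxy) !andbF.
(* If [yr] is an edge, the removal of [r] from [B] is made up for by [y] as a further neighbour of
   [r]. *)
rewrite cardB; case: (boolP (G y r)) => [yr|nyr].
  have sub_ry : y |: (w |: (x |: (B :\ v :\ r))) \subset [set s | G r s].
    by rewrite subUset sub1set inE adj_sym yr.
  apply: leq_trans (subset_leq_card sub_ry).
  rewrite cardsU1 card_wx !inE adj_irr !andbF (eq_sym y w) (negbTE neq_wy).
  rewrite (eq_sym y x) (negbTE neq_xy) (cardsD1 r (B :\ v)) !inE rv yr.
  by rewrite !add1n.
apply: leq_trans (subset_leq_card sub_r); rewrite card_wx.
by rewrite (cardsD1 r (B :\ v)) !inE (negbTE nyr) andbF.
Qed.

(** By [transfers_nbr], [r] is adjacent to neither [y] nor [z]; hence [r] differs from [s] and is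
    adjacent to it, which makes [s] adjacent to [z]. Then [transfers y z] would force the edge [zr],
    and [transfers y x] the edge [xz]. *)
Lemma transfers_trio x y z r s : G v x -> G v y -> G v z ->
    x != y -> x != z -> y != z -> ~~ G x y -> ~~ G x z -> ~~ G y z ->
    outer r -> G x r -> outer s -> G y s ->
    transfers x y -> transfers x z -> ~ (transfers y z \/ transfers y x).
Proof.
move=> vx vy vz neq_xy neq_xz neq_yz nxy nxz nyz or xr os ys txy txz.
have nry : ~~ G r y.
  apply/negP=> ry; have := transfers_nbr vx vz neq_xz nxz txz or xr ry.
  by rewrite (eq_sym y) neq_xy neq_yz adj_sym (negbTE nyz) => /(_ isT isT).
have nrz : ~~ G r z.
  apply/negP=> rz; have := transfers_nbr vx vy neq_xy nxy txy or xr rz.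
  by rewrite !(eq_sym z) neq_xz neq_yz (negbTE nyz) => /(_ isT isT).
have rs : G r s.
  apply: txy => //; first by case/andP: os.
  by apply: contraNneq nry => <-; rewrite adj_sym.
have sz : G z s.
  apply: (transfers_nbr vx vz neq_xz nxz txz or xr rs).
    by rewrite eq_sym outer_neq.
  by rewrite eq_sym outer_neq.
case=> [tyz|tyx].
  have := transfers_nbr vy vz neq_yz nyz tyz os ys.
  move=> /(_ r); rewrite !(eq_sym r) !outer_neq // !(adj_sym G _ r).
  by rewrite (negbTE nrz) rs => /(_ isT isT isT).
have nyx : ~~ G y x by rewrite adj_sym.
have neq_yx : y != x by rewrite eq_sym.
have := transfers_nbr vy vx neq_yx nyx tyx os ys.
move=> /(_ z); rewrite (adj_sym G s) sz !(eq_sym z) neq_xz neq_yz (negbTE nxz).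
by move=> /(_ isT isT isT).
Qed.

Lemma outer_nbr x c : G v x -> (forall s, G v s -> G x s -> s = c) ->
  exists2 r, outer r & G x r.
Proof.
move=> vx only_c; have [r xr] := nbr_avoiding (s := [:: v; c]) (deg_nbr vx).
rewrite !inE negb_or => /andP[rv rc]; exists r => //.
rewrite /outer rv andbT; apply/negP=> vr.
by rewrite (only_c r vr xr) eqxx in rc.
Qed.

(** All neighbours of [y] but [v] are outer, so [outer_nbrs_adj] applies to each. *)
Lemma transfers_isolated x y : G v x -> G v y -> x != y ->
  (forall s, G v s -> ~~ G y s) -> transfers x y.
Proof.
move=> vx vy neq_xy iso_y r s or xr ys sv sr.
have nxy : ~~ G x y by rewrite adj_sym iso_y.
apply: (outer_nbrs_adj vx vy neq_xy nxy or _ xr ys); last by rewrite eq_sym.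
by rewrite /outer sv andbT; apply: contraTN ys; apply: iso_y.
Qed.

(** The one inside neighbour [c] of [y] is handled by [outer_nbr_adj], with [cz] as the second edge;
    the others are outer. *)
Lemma transfers_leaf x y c z : G v x -> G v y -> G v c -> G v z ->
    x != y -> ~~ G x y -> (forall s, G v s -> G y s -> s = c) -> G y c ->
    G c z -> z != x -> z != y ->
  transfers x y.
Proof.
move=> vx vy vc vz neq_xy nxy only_c yc cz neq_zx neq_zy r s or xr ys sv sr.
have [vs|nvs] := boolP (G v s); last first.
  apply: (outer_nbrs_adj vx vy neq_xy nxy or _ xr ys); last by rewrite eq_sym.
  by rewrite /outer sv nvs.
rewrite (only_c s vs ys).
exact: (outer_nbr_adj vx vy vc vz or neq_xy nxy xr yc cz).
Qed.

(** Both [x] and [y] are leaves at [c], since another inside edge at one of them would close a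
    triangle or give a matching. A further neighbour [w] of [v] has no inside neighbour but possibly
    [c], and [transfers_trio] refutes [w], [x], [y]. *)
Lemma no_star c x y : G v c -> G v x -> G v y -> x != y -> G c x -> G c y ->
  False.
Proof.
move=> vc vx vy neq_xy cx cy.
have leaf l m s : G v l -> G v m -> l != m -> G c l -> G c m ->
    G v s -> G l s -> s = c.
  move=> vl vm neq_lm cl cm vs ls; apply: contraTeq isT => neq_sc; exfalso.
  have [eq_sm|neq_sm] := eqVneq s m.
    by apply: (no_triangle vc vl vm cl _ cm); rewrite -eq_sm.
  apply: (no_matchingG vl vs vc vm ls cm) => //.
  by rewrite eq_sym (adj_neq cl).
have [w vw] := nbr_avoiding (s := [:: c; x; y]) deg_v.
rewrite !inE !negb_or => /and3P[neq_wc neq_wx neq_wy].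
have leaf_x := leaf x y _ vx vy neq_xy cx cy.
have neq_yx : y != x by rewrite eq_sym.
have leaf_y := leaf y x _ vy vx neq_yx cy cx.
have nadj l m : (forall s, G v s -> G l s -> s = c) -> G v m -> m != c ->
    ~~ G l m.
  by move=> only_c vm neq_mc; apply: contraNN neq_mc => /only_c ->.
have neq_xc : x != c by rewrite eq_sym (adj_neq cx).
have neq_yc : y != c by rewrite eq_sym (adj_neq cy).
have [r or xr] := outer_nbr vx leaf_x.
have [s os ys] := outer_nbr vy leaf_y.
have nxy := nadj _ _ leaf_x vy neq_yc.
have nxw := nadj _ _ leaf_x vw neq_wc.
have nyw := nadj _ _ leaf_y vw neq_wc.
have nwx : ~~ G w x by rewrite adj_sym.
have nwy : ~~ G w y by rewrite adj_sym.
have xc : G x c by rewrite adj_sym.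
have yc : G y c by rewrite adj_sym.
have neq_xw : x != w by rewrite eq_sym.
have neq_yw : y != w by rewrite eq_sym.
have only_w u : G v u -> G w u -> u = c.
  move=> vu wu; apply: contraTeq isT => neq_uc; exfalso.
  have [eq_ux|neq_ux] := eqVneq u x; first by rewrite -eq_ux wu in nwx.
  by apply: (no_matchingG vw vu vc vx wu cx).
have [t ot wt] := outer_nbr vw only_w.
apply: (transfers_trio vw vx vy neq_wx neq_wy neq_xy nwx nwy nxy ot wt or xr).
- exact: (transfers_leaf vw vx vc vy).
- exact: (transfers_leaf vw vy vc vx).
(* Inside the neighbourhood, [w] is either a third leaf at [c] or isolated. *)
right; have [cw|ncw] := boolP (G c w).
  by apply: (transfers_leaf vx vw vc vy) => //; rewrite adj_sym.
apply: transfers_isolated => // u vu; apply/negP=> wu.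
by rewrite -(only_w u vu wu) adj_sym wu in ncw.
Qed.

(** The parameter [c] lets [x] be an end of a single inside edge or an isolated vertex. *)
Lemma no_two_isolated x i j c : G v x -> G v i -> G v j ->
    x != i -> x != j -> i != j ->
    (forall s, G v s -> ~~ G i s) -> (forall s, G v s -> ~~ G j s) ->
    (forall s, G v s -> G x s -> s = c) ->
  False.
Proof.
move=> vx vi vj neq_xi neq_xj neq_ij iso_i iso_j only_c.
(* The premises conflict, so [v] is just a filler for the sole inside neighbour in [outer_nbr]. *)
have iso_eq s : G v s -> G i s -> s = v by move=> /iso_i/negbTE->.
have [r or xr] := outer_nbr vx only_c.
have [s os i_s] := outer_nbr vi iso_eq.
apply: (transfers_trio vx vi vj neq_xi neq_xj neq_ij _ _ _ or xr os i_s).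
- by rewrite adj_sym iso_i.
- by rewrite adj_sym iso_j.
- exact: iso_i.
- exact: transfers_isolated.
- exact: transfers_isolated.
by left; exact: transfers_isolated.
Qed.

(** Two further neighbours [i], [j] of [v] are isolated inside: an edge at one of them would form a
    star or a matching with [ab]. *)
Lemma no_inside_edge a b : G v a -> G v b -> G a b -> False.
Proof.
move=> va vb ab.
have [i vi] := nbr_avoiding (s := [:: a; b]) (ltnW deg_v).
rewrite !inE negb_or => /andP[neq_ia neq_ib].
have [j vj] := nbr_avoiding (s := [:: a; b; i]) deg_v.
rewrite !inE !negb_or => /and3P[neq_ja neq_jb neq_ji].
have iso k : G v k -> k != a -> k != b -> forall s, G v s -> ~~ G k s.
  move=> vk neq_ka neq_kb s vs; apply/negP=> ks.
  have [eq_sa|neq_sa] := eqVneq s a.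
    apply: (no_star va vk vb neq_kb _ ab); by rewrite -eq_sa adj_sym.
  have [eq_sb|neq_sb] := eqVneq s b.
    by apply: (no_star vb vk va neq_ka); rewrite -?eq_sb adj_sym // eq_sb.
  exact: (no_matchingG vk vs va vb).
have only_b s : G v s -> G a s -> s = b.
  move=> vs a_s; apply: contraTeq isT => neq_sb; exfalso.
  exact: (no_star va vs vb neq_sb).
apply: (no_two_isolated va vi vj _ _ _ _ _ only_b); rewrite 1?eq_sym //.
- exact: iso.
- exact: iso.
Qed.

Lemma local_matching_absurd : False.
Proof.
have [i vi _] := nbr_avoiding (s := [::]) (ltn_trans (isT : 0 < 3) deg_v).
have [j vj] := nbr_avoiding (s := [:: i]) (ltn_trans (isT : 1 < 3) deg_v).
rewrite inE => neq_ji.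
have [k vk] := nbr_avoiding (s := [:: i; j]) (ltnW deg_v).
rewrite !inE negb_or => /andP[neq_ki neq_kj].
have iso x s : G v x -> G v s -> ~~ G x s.
  by move=> vx vs; apply/negP; exact: no_inside_edge.
apply: (@no_two_isolated k i j v) => // [|s vs|s vs|s vs].
- by rewrite eq_sym.
- exact: iso.
- exact: iso.
by rewrite (negbTE (iso k s vk vs)).
Qed.

End LocalMatching.

(** * Choice of an extremal realization *)

(** Degree zero is allowed because deleted vertices stay in the type as isolated ones. *)
Lemma bowtie_of_large_degrees (V : finType) (G : sgraph V) v :
    (forall x, 0 < degree G x -> 3 <= degree G x) -> 4 <= degree G v ->
  exists H : sgraph V, degree H =1 degree G /\ bowtie H.
Proof.
move=> deg3 deg4; apply: contrapT => no_bow.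
pose nbr_weight (H : sgraph V) := \sum_(x | H v x) degree G x.
have [||G1 [deg1 max1]] :=
    @exists_max _ (fun H => degree H =1 degree G) nbr_weight
      (\sum_x degree G x).
- by exists G.
- by move=> H _; rewrite [leqRHS](bigID (H v)) leq_addr.
(* If [r] had larger degree than [x], it would have a neighbour [w] other than [x] and not adjacent
   to [x]. Switching [vx], [rw] into [vr], [xw] would then increase the weight. *)
have top x r : G1 v x -> ~~ G1 v r -> r != v -> degree G r <= degree G x.
  move=> vx nvr rv; rewrite leqNgt; apply/negP=> lt_xr.
  have neq_xr : x != r by apply: contraNneq nvr => <-.
  have [w rw|sub] := pickP [pred w | G1 r w && ~~ G1 x w && (w != x)];
      last first.
    move: lt_xr; rewrite ltnNge -!deg1 => /negP[].
    rewrite /degree [leqRHS](cardsD1 v) inE adj_sym vx.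
    have : [set w | G1 r w] \subset x |: ([set w | G1 x w] :\ v).
      apply/subsetP=> w; rewrite !inE => rw; have := sub w; rewrite /= rw.
      have [//|neq_wx] := eqVneq w x; rewrite andbT => /negbFE->.
      by rewrite andbT; apply: contraNneq nvr => <-; rewrite adj_sym.
    move=> /subset_leq_card/leq_trans; apply.
    by rewrite cardsU1 leq_add2r leq_b1.
  case/andP: rw => /andP[rw nxw] neq_wx.
  have neq_vr : v != r by rewrite eq_sym.
  have neq_xw : x != w by rewrite eq_sym.
  have degH := degree_switch vx rw nvr nxw neq_vr neq_xw.
  have degH' : degree (switch G1 v x r w) =1 degree G.
    by move=> y; rewrite degH deg1.
  have := max1 _ degH'; rewrite leqNgt => /negP[].
  have nbr_v y : switch G1 v x r w v y = (y \in r |: ([set y | G1 v y] :\ x)).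
    by rewrite -(switch_nbr vx rw nvr neq_vr) inE.
  rewrite /nbr_weight (eq_bigl _ _ nbr_v) big_setU1 /=; last first.
    by rewrite !inE (negbTE nvr) andbF.
  rewrite (bigD1 x) //= -addSn leq_add //.
  by apply: eq_leq; apply: eq_bigl => y; rewrite !inE andbC.
have [||G2 [[deg2 nbr2] max2]] := @exists_max _
    (fun H => degree H =1 degree G /\ H v =1 G1 v)
    (fun H => #|edges_inside G1 v H|) #|{: V * V}|.
- by exists G1.
- by move=> H _; exact: max_card.
apply: (@local_matching_absurd V G2 v).
- move=> H degH bowH; apply: no_bow; exists H; split=> // x.
  by rewrite degH deg2.
- move=> x vx; rewrite deg2 deg3 // -deg2; apply/card_gt0P; exists v.
  by rewrite inE adj_sym.
- by rewrite deg2.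
- by move=> x r; rewrite !nbr2 !deg2; exact: top.
move=> H degH nbrH.
have eq_inside K : edges_inside G2 v K = edges_inside G1 v K.
  by apply/setP=> z; rewrite !inE !nbr2.
rewrite !eq_inside; apply: max2; split=> x; first by rewrite degH deg2.
by rewrite nbrH nbr2.
Qed.

(** * Edge-disjoint unions and deletion of a vertex *)

Section Union.

Variables (V : finType) (G H : sgraph V).

Definition union_adj : rel V := [rel x y | G x y || H x y].

Lemma union_sym : symmetric union_adj.
Proof. by move=> x y; rewrite /union_adj /= (adj_sym G) (adj_sym H). Qed.

Lemma union_irr : irreflexive union_adj.
Proof. by move=> x; rewrite /union_adj /= !adj_irr. Qed.

Definition graph_union : sgraph V := SGraph union_sym union_irr.

Lemma degree_union : (forall x y, G x y -> ~~ H x y) ->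
  forall x, degree graph_union x = degree G x + degree H x.
Proof.
move=> disj x; rewrite /degree.
have -> : [set w | graph_union x w] = [set w | G x w] :|: [set w | H x w].
  by apply/setP=> w; rewrite !inE.
rewrite cardsU (_ : _ :&: _ = set0) ?cards0 ?subn0 //.
by apply/setP=> w; rewrite !inE; apply/negP=> /andP[/disj/negP].
Qed.

End Union.

Section DeleteVertex.

Variables (V : finType) (G : sgraph V) (v : V).

(** The edges at [v] and the remaining ones are graphs on the same type, so that degrees add;
    deletion leaves [v] isolated. *)
Definition star_adj : rel V := [rel x y | G x y && ((x == v) || (y == v))].
Definition delete_adj : rel V := [rel x y | G x y && ~~ ((x == v) || (y == v))].

Lemma star_sym : symmetric star_adj.
Proof. by move=> x y; rewrite /star_adj /= adj_sym orbC. Qed.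

Lemma star_irr : irreflexive star_adj.
Proof. by move=> x; rewrite /star_adj /= adj_irr. Qed.

Lemma delete_sym : symmetric delete_adj.
Proof. by move=> x y; rewrite /delete_adj /= adj_sym orbC. Qed.

Lemma delete_irr : irreflexive delete_adj.
Proof. by move=> x; rewrite /delete_adj /= adj_irr. Qed.

Definition star : sgraph V := SGraph star_sym star_irr.
Definition delete : sgraph V := SGraph delete_sym delete_irr.

Lemma starE x y : star x y = G x y && ((x == v) || (y == v)).
Proof. by []. Qed.

Lemma deleteE x y : delete x y = G x y && ~~ ((x == v) || (y == v)).
Proof. by []. Qed.

Lemma degree_delete_star x : degree G x = degree delete x + degree star x.
Proof.
rewrite -degree_union => [|y z /andP[yz nv]]; last by rewrite starE yz.
apply: eq_degree => y z; change (G y z = delete y z || star y z).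
by rewrite deleteE starE -andb_orr orNb andbT.
Qed.

Lemma degree_delete_self : degree delete v = 0.
Proof.
apply/eqP; rewrite cards_eq0; apply/eqP/setP=> w.
by rewrite !inE deleteE eqxx andbF.
Qed.

Lemma sum_degree_star : \sum_x degree star x <= (degree G v).*2.
Proof.
rewrite (bigD1 v) //= -addnn leq_add //.
  by rewrite [leqRHS]degree_delete_star leq_addl.
rewrite /degree -sum1dep_card [leqRHS]big_mkcond [leqLHS]big_mkcond.
apply: leq_sum => x _; have [//|neq_xv] := eqVneq x v.
have [vx|nvx] := boolP (G v x).
  rewrite -[1](cards1 v); apply/subset_leq_card/subsetP=> w.
  by rewrite !inE starE (negbTE neq_xv) => /andP[].
rewrite leqn0 cards_eq0; apply/eqP/setP=> w; rewrite !inE starE (negbTE neq_xv).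
by apply/negP=> /andP[xw /eqP eq_wv]; rewrite adj_sym -eq_wv xw in nvx.
Qed.

End DeleteVertex.

(** * Graphs with all edges in a given vertex set, and the induction on its size *)

Lemma degree_eq0 (V : finType) (G : sgraph V) x y :
  degree G x = 0 -> ~~ G x y.
Proof.
by move=> /eqP; rewrite cards_eq0 => /eqP/setP/(_ y); rewrite !inE => ->.
Qed.

Lemma degree_out (V : finType) (G : sgraph V) (A : {set V}) x :
  (forall x y, G x y -> x \in A) -> x \notin A -> degree G x = 0.
Proof.
move=> sub_A nAx; apply/eqP; rewrite cards_eq0; apply/eqP/setP=> y.
by rewrite !inE; apply: contraNF nAx; apply: sub_A.
Qed.

Lemma sum_degree_in (V : finType) (G : sgraph V) (A : {set V}) :
  (forall x y, G x y -> x \in A) ->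
  \sum_x degree G x = \sum_(x in A) degree G x.
Proof.
move=> sub_A; rewrite (bigID (mem A)) /= [X in _ + X]big1 ?addn0 // => x.
exact: degree_out.
Qed.

Lemma degree_lt_card (V : finType) (G : sgraph V) (A : {set V}) x :
  (forall x y, G x y -> x \in A) -> x \in A -> degree G x < #|A|.
Proof.
move=> sub_A Ax; rewrite (cardsD1 x) Ax ltnS; apply/subset_leq_card/subsetP=> w.
by rewrite !inE => xw; rewrite eq_sym (adj_neq xw) (sub_A w x) // adj_sym.
Qed.

(** The four degrees in [A] are at most 3, so a sum of 12 makes each equal to 3. *)
Lemma complete_of_degree_sum (V : finType) (G : sgraph V) (A : {set V}) :
    (forall x y, G x y -> x \in A) -> #|A| = 4 -> 12 <= \sum_x degree G x ->
  forall x y, x \in A -> y \in A -> x != y -> G x y.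
Proof.
move=> sub_A cardA le12 x y Ax Ay neq_xy.
have sub_nbr z : [set w | G z w] \subset A :\ z.
  apply/subsetP=> w; rewrite !inE => zw.
  by rewrite eq_sym (adj_neq zw) (sub_A w z) // adj_sym.
have cardD z : z \in A -> #|A :\ z| = 3.
  by move=> Az; move: cardA; rewrite (cardsD1 z) Az => -[].
have deg_le z : z \in A -> degree G z <= 3.
  by move=> Az; rewrite -ltnS -cardA degree_lt_card.
have deg_x : 3 <= degree G x.
  have le9 : \sum_(z in A :\ x) degree G z <= 9.
    rewrite -[9]/(3 * 3) -{1}(cardD x Ax) -sum_nat_const leq_sum // => z.
    by rewrite !inE => /andP[_]; apply: deg_le.
  rewrite -(leq_add2r 9); apply: leq_trans le12 _.
  by rewrite (sum_degree_in sub_A) (big_setD1 x) //= leq_add2l.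
have : y \in A :\ x by rewrite !inE eq_sym neq_xy.
suff <- : [set w | G x w] = A :\ x by rewrite inE.
by apply/eqP; rewrite eqEcard sub_nbr cardD.
Qed.

(** Deleting a vertex of degree at most 2 lowers the sum by at most 4, exactly the decrease of the
    bound [4k - 4]. The set [A] holds the vertices not yet deleted. *)
Lemma bowtie_of_degree_sum (V : finType) k (G : sgraph V) (A : {set V}) :
    5 <= k -> #|A| = k -> (forall x y, G x y -> x \in A) ->
    4 * k <= \sum_x degree G x + 4 ->
  exists H : sgraph V, degree H =1 degree G /\ bowtie H.
Proof.
elim: k G A => // k IHk G A le5 cardA sub_A le_sum.
have [v /andP[Av deg_v]|deg3] := pickP [pred v in A | degree G v <= 2];
    last first.
  have deg3A x : x \in A -> 3 <= degree G x.
    by move=> Ax; have := deg3 x; rewrite /= Ax ltnNge => /= ->.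
  have [v deg4|deg_le3] := pickP [pred v | 4 <= degree G v].
    apply: (@bowtie_of_large_degrees _ _ v) => // x; apply: contraTT.
    rewrite -leqNgt -eqn0Ngt => le2; apply/eqP/(degree_out sub_A).
    by apply/negP=> /deg3A; rewrite leqNgt ltnS le2.
  (* With all degrees at most 3 the sum would stay below [4(k + 1) - 4], as [k + 1 >= 5]. *)
  have : \sum_x degree G x <= 3 * k.+1.
    rewrite (sum_degree_in sub_A) mulnC -cardA -sum_nat_const leq_sum // => x _.
    by rewrite leqNgt; exact/negbT/deg_le3.
  rewrite -(leq_add2r 4) => /(leq_trans le_sum).
  by rewrite -[4]/(3.+1) mulSn addnC leq_add2l leqNgt le5.
have cardA' : #|A :\ v| = k by move: cardA; rewrite (cardsD1 v) Av => -[].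
have sub_A' x y : delete G v x y -> x \in A :\ v.
  rewrite deleteE negb_or !inE => /and3P[xy -> _]; exact: sub_A xy.
have sum_le :
    \sum_x degree G x <= \sum_x degree (delete G v) x + (degree G v).*2.
  rewrite (eq_bigr _ (fun x _ => degree_delete_star G v x)) big_split /=.
  by rewrite leq_add2l sum_degree_star.
have sum_le4 : \sum_x degree G x <= \sum_x degree (delete G v) x + 4.
  by apply: leq_trans sum_le _; rewrite leq_add2l -[4]/(2.*2) leq_double.
have le_sum' : 4 * k <= \sum_x degree (delete G v) x + 4.
  rewrite -(leq_add2l 4) -mulnS; apply: leq_trans le_sum _.
  by rewrite addnC leq_add2l.
have [le5k|lt5k] := leqP 5 k.
  have [H [degH [c [x1 [y1 [x2 [y2 [t1 t2 dist]]]]]]]] :=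
    IHk _ _ le5k cardA' sub_A' le_sum'.
  (* As [v] is isolated in [H], its star can be put back without doubling an edge. *)
  have isoH y : ~~ H v y by apply: degree_eq0; rewrite degH degree_delete_self.
  exists (graph_union H (star G v)); split=> [x|].
    rewrite degree_union => [|y z yz].
      by rewrite degH -degree_delete_star.
    rewrite starE negb_and negb_or; apply/orP; right.
    have neq_v u w : H u w -> u != v by apply: contraTneq => ->.
    by rewrite (neq_v _ _ yz) (neq_v z y) // adj_sym.
  have sub_H u w : H u w -> graph_union H (star G v) u w.
    by move=> uw; apply/orP; left.
  exists c, x1, y1, x2, y2; split=> //; apply/and3P.
    by case/and3P: t1; split; apply: sub_H.
  by case/and3P: t2; split; apply: sub_H.
have k4 : k = 4 by apply/eqP; rewrite eqn_leq -ltnS lt5k -ltnS le5.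
rewrite {k lt5k le5 IHk}k4 in cardA cardA' le_sum le_sum'.
have ge12 : 12 <= \sum_x degree (delete G v) x by rewrite -(leq_add2r 4).
have K4 := complete_of_degree_sum sub_A' cardA' ge12.
(* The sum is at least 16 and [K4] accounts for 12, so twice the degree of [v] is at least 4. *)
have deg_v2 : 2 <= degree G v.
  have le12 : \sum_x degree (delete G v) x <= 12.
    rewrite (sum_degree_in sub_A') -[12]/(4 * 3) -cardA' -sum_nat_const.
    by apply: leq_sum => x A'x; rewrite -ltnS -cardA' degree_lt_card.
  rewrite -leq_double -(leq_add2l 12) -(leq_add2r 4).
  apply: leq_trans le_sum _; rewrite leq_add2r.
  by apply: leq_trans sum_le _; rewrite leq_add2r.
have [a va _] := nbr_avoiding (s := [::]) (ltnW deg_v2).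
have [b vb] := nbr_avoiding (s := [:: a]) deg_v2; rewrite inE => neq_ba.
have nbr_A' x : G v x -> x \in A :\ v.
  by move=> vx; rewrite !inE eq_sym (adj_neq vx) (sub_A x v) // adj_sym.
have A'a := nbr_A' a va; have A'b := nbr_A' b vb.
have /eqP/cards2P[c [d [neq_cd eq_cd]]] : #|A :\ v :\ a :\ b| = 2.
  have := cardA'; rewrite (cardsD1 a) A'a (cardsD1 b) [b \in _]inE A'b.
  by rewrite inE neq_ba => -[].
have /setD1P[neq_cb /setD1P[neq_ca A'c]] : c \in A :\ v :\ a :\ b.
  by rewrite eq_cd !inE eqxx.
have /setD1P[neq_db /setD1P[neq_da A'd]] : d \in A :\ v :\ a :\ b.
  by rewrite eq_cd !inE eqxx orbT.
have K4G x y : x \in A :\ v -> y \in A :\ v -> x != y -> G x y.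
  by move=> A'x A'y neq_xy; have := K4 x y A'x A'y neq_xy; case/andP.
(* The triangles [avb] and [acd] share [a], where [c] and [d] are the vertices of the [K4] other
   than [a] and [b]. *)
exists G; split=> //; exists a, v, b, c, d; split.
- by rewrite adj_sym va vb K4G // eq_sym.
- by rewrite !K4G // eq_sym.
have neq_v x : x \in A :\ v -> v != x by case/setD1P; rewrite eq_sym.
by rewrite !neq_v // !(eq_sym b) neq_cb.
Qed.

(** * [K5 - C4] as a bowtie *)

Lemma cycle4E (a b : 'I_4) : cycle_graph 4 a b = (odd a != odd b).
Proof. by case: a b => [[|[|[|[|//]]]] ?] [[|[|[|[|//]]]] ?]. Qed.

(** The vertex 4 lies off the removed cycle, and [C4] is complete bipartite between even and odd
    vertices. *)
Lemma K5_minus_C4E (x y : 'I_5) :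
  K5_minus_C4 x y =
    (x != y) && [|| x == 4 :> nat, y == 4 :> nat | odd x == odd y].
Proof.
have lt4 (z : 'I_5) : z != 4 :> nat -> z < 4.
  by move=> neq_z4; have := ltn_ord z; rewrite ltnS leq_eqVlt (negbTE neq_z4).
congr (_ && _); apply/idP/idP => [|edge].
  apply: contraR; rewrite !negb_or => /and3P[/lt4 x4 /lt4 y4 odd_xy].
  apply/existsP; exists (Ordinal x4); apply/existsP; exists (Ordinal y4).
  by rewrite cycle4E odd_xy andbT; apply/andP; split; apply/eqP/val_inj.
apply/existsP=> -[a /existsP[b /and3P[/eqP eq_ax /eqP eq_by]]].
rewrite cycle4E; apply/negP; rewrite negbK; move: edge.
by rewrite -eq_ax -eq_by /= !(ltn_eqF (ltn_ord _)).
Qed.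

Lemma contains_bowtie (V : finType) (G : sgraph V) :
  bowtie G -> contains G K5_minus_C4.
Proof.
move=> [c [x1 [y1 [x2 [y2 [/and3P[cx1 cy1 xy1] /and3P[cx2 cy2 xy2]]]]]]].
move=> /and4P[neq_xx neq_xy neq_yx neq_yy].
(* The removed 4-cycle on 0, 1, 2, 3 leaves the edges 0-2 and 1-3. *)
pose s := [:: x1; x2; y1; y2; c].
have uniq_s : uniq s.
  rewrite /= !inE !negb_or neq_xx neq_xy neq_yy (adj_neq xy1) (adj_neq xy2).
  rewrite (eq_sym x2) neq_yx !(eq_sym _ c) (adj_neq cx1) (adj_neq cx2).
  by rewrite (adj_neq cy1) (adj_neq cy2).
exists (fun i : 'I_5 => nth c s i); split=> [i j /eqP|].
  by rewrite nth_uniq // => /eqP/val_inj.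
move=> i j; rewrite K5_minus_C4E -(inj_eq val_inj) /=.
by case: i j => [[|[|[|[|[|//]]]]] ?] [[|[|[|[|[|//]]]]] ?] //= _;
  rewrite // adj_sym.
Qed.

(** * The extremal sequence, with two hubs of full degree *)

Section Extremal.

Variable n : nat.
Hypothesis n_ge2 : 2 <= n.

Definition hub_adj : rel 'I_n :=
  [rel x y : 'I_n | (x != y) && ((x < 2) || (y < 2))].

Lemma hub_sym : symmetric hub_adj.
Proof. by move=> x y; rewrite /hub_adj /= eq_sym orbC. Qed.

Lemma hub_irr : irreflexive hub_adj.
Proof. by move=> x; rewrite /hub_adj /= eqxx. Qed.

Definition hub_graph : sgraph 'I_n := SGraph hub_sym hub_irr.

Definition hub_degrees : n.-tuple nat :=
  [tuple if i < 2 then n.-1 else 2 | i < n].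

Lemma card_hubs : #|[set i : 'I_n | i < 2]| = 2.
Proof.
have -> : [set i : 'I_n | i < 2] =
    [set Ordinal (ltnW n_ge2); Ordinal n_ge2].
  by apply/setP=> -[[|[|i]] lt_in]; rewrite !inE -!(inj_eq val_inj).
by rewrite cards2.
Qed.

Lemma hub_graphical : graphical hub_degrees.
Proof.
exists hub_graph => i; rewrite tnth_mktuple.
case: ifPn => [i_hub|i_nhub].
  rewrite -[in RHS](card_ord n) -(cardsC1 i); apply: eq_card => j.
  by rewrite !inE /= /hub_adj /= i_hub andbT eq_sym.
rewrite -card_hubs; apply: eq_card => j.
rewrite !inE /= /hub_adj /= (negbTE i_nhub) /= andbC.
by case: (boolP (j < 2)) => //= j_hub; apply: contraNneq i_nhub => ->.
Qed.

Lemma sum_hub_degrees : sumn hub_degrees = 4 * n - 6.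
Proof.
rewrite sumnE big_tuple (eq_bigr _ (fun i _ => tnth_mktuple _ i)).
case: n n_ge2 => [|[|m]] // _; rewrite !big_ord_recl /=.
by rewrite sum_nat_const card_ord; lia.
Qed.

(** In any realization a hub is adjacent to all other vertices, so the two hubs exhaust the
    neighbours of a vertex of degree 2. *)
Lemma hub_edges (G : sgraph 'I_n) x y : realizes G hub_degrees -> G x y ->
  (x < 2) || (y < 2).
Proof.
move=> degG xy; have [//|x_nhub] := boolP (x < 2).
have hub_nbrs (i j : 'I_n) : i < 2 -> i != j -> G i j.
  move=> i_hub neq_ij; have : j \in [set~ i] by rewrite !inE eq_sym.
  suff <- : [set w | G i w] = [set~ i] by rewrite inE.
  apply/eqP; rewrite eqEcard cardsC1 card_ord -/(degree G i) degG tnth_mktuple.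
  rewrite i_hub leqnn andbT; apply/subsetP=> w; rewrite !inE => iw.
  by rewrite eq_sym (adj_neq iw).
suff /setP/(_ y) : [set i : 'I_n | i < 2] = [set w | G x w].
  by rewrite !inE xy.
apply/eqP; rewrite eqEcard card_hubs -/(degree G x) degG tnth_mktuple.
rewrite (negbTE x_nhub) leqnn andbT; apply/subsetP=> i; rewrite !inE => i_hub.
by rewrite adj_sym hub_nbrs //; apply: contraNneq x_nhub => <-.
Qed.

Lemma hub_not_potentially : ~ potentially K5_minus_C4 hub_degrees.
Proof.
move=> [G [degG [f [inj_f edge_f]]]].
have hub i j : K5_minus_C4 i j -> (f i < 2) || (f j < 2).
  by move=> /edge_f; apply: hub_edges.
have three i j k : uniq [:: i; j; k] -> f i < 2 -> f j < 2 -> f k < 2 -> False.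
  have inj_vf : injective (fun i => f i : nat) by move=> ? ? /val_inj/inj_f.
  rewrite -(map_inj_uniq inj_vf) => uniq_f fi fj fk.
  suff /(uniq_leq_size uniq_f) :
    {subset [seq (f i : nat) | i <- [:: i; j; k]] <= iota 0 2} by [].
  by move=> u; rewrite mem_iota /= !inE => /or3P[] /eqP->.
have K x y : (x != y) && [|| x == 4, y == 4 | odd x == odd y] ->
    forall (x5 : x < 5) (y5 : y < 5),
  (f (Ordinal x5) < 2) || (f (Ordinal y5) < 2).
  by move=> xy x5 y5; apply: hub; rewrite K5_minus_C4E -(inj_eq val_inj).
have := K 4 0 isT isT isT; have := K 4 2 isT isT isT; have := K 0 2 isT isT isT.
have := K 4 1 isT isT isT; have := K 4 3 isT isT isT; have := K 1 3 isT isT isT.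
set i0 := @Ordinal 5 0 _; set i1 := @Ordinal 5 1 _; set i2 := @Ordinal 5 2 _.
set i3 := @Ordinal 5 3 _; set i4 := @Ordinal 5 4 _.
(* If the centre is sent to a hub, the edges [02] and [13] each need another hub; if not, its four
   neighbours are all sent to hubs. *)
have [f4 /orP h13 _ _ /orP h02 _ _|/negbTE f4 _ /= f3 f1 _ f2 f0] :=
  boolP (f i4 < 2).
  by case: h13 => [f1|f3]; case: h02 => [f0|f2];
    [apply: (three i4 i1 i0) | apply: (three i4 i1 i2)
    |apply: (three i4 i3 i0) | apply: (three i4 i3 i2)].
exact: (three i0 i1 i2).
Qed.

End Extremal.

(** * Matching bounds for [sigma] *)

Theorem theorem2 (n : nat) (hn : 5 <= n) : sigma K5_minus_C4 n = 4 * n - 4.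
Proof.
have n_ge2 : 2 <= n := leq_trans (isT : 2 <= 5) hn.
have forces_bound : forces K5_minus_C4 n (4 * n - 4).
  move=> S [G degG] le_S.
  have sum_G : \sum_i degree G i = sumn S.
    by rewrite sumnE big_tuple; apply: eq_bigr => i _; exact: degG.
  have [|||H [degH bowH]] := @bowtie_of_degree_sum _ n G [set: 'I_n] hn.
  - by rewrite cardsT card_ord.
  - by move=> x y _; rewrite inE.
  - by rewrite sum_G addnC -leq_subLR.
  exists H; split; last exact: contains_bowtie.
  by move=> i; rewrite degH degG.
rewrite /sigma; case: ex_minnP => m /andP[even_m /asboolP forces_m] min_m.
apply/eqP; rewrite eqn_leq min_m /=; last first.
  by apply/andP; split; [lia | apply/asboolP].
rewrite leqNgt; apply/negP=> lt_m.
apply: (@hub_not_potentially n n_ge2); apply: forces_m.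
  exact: hub_graphical.
(* Being even and below [4n - 4], [m] is at most [4n - 6]. *)
by rewrite sum_hub_degrees //; lia.
Qed.
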